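(* Let $N=p_1^{\alpha_1}\cdots p_k^{\alpha_k}$ with distinct primes $p_j$ and $\alpha_j\ge1$, and let $A(X),B(X),C(X),D(X)$ be polynomials modulo $X^N-1$ with integer coefficients, with weight functions $w_A,w_B,w_C,w_D:\mathbb{Z}_N\to\mathbb{Z}$ (coefficient of $X^x$). For $m\mid N$ set $\mathbb{A}^N_m[C]=\sum_{a,c\in\mathbb{Z}_N}w_A(a)w_C(c)\mathbf 1_{\gcd(a-c,N)=m}$ and similarly $\mathbb{B}^N_m[D]$. Then $$\sum_{m\mid N}\frac{1}{\phi(N/m)}\mathbb{A}^N_m[C]\,\mathbb{B}^N_m[D]=\sum_{d\mid N}\frac{1}{N\phi(d)}\Big[\sum_{\zeta:\Phi_d(\zeta)=0}A(\zeta)\overline{C(\zeta)}\Big]\Big[\sum_{\zeta:\Phi_d(\zeta)=0}B(\zeta)\overline{D(\zeta)}\Big].$$ In particular, $$\sum_{m\mid N}\frac{1}{\phi(N/m)}\mathbb{A}^N_m[A]\,\mathbb{B}^N_m[B]=\sum_{d\mid N}\frac{1}{N\phi(d)}\mathcal{E}_d(A)\mathcal{E}_d(B),\qquad \mathcal{E}_d(A)=\sum_{\zeta:\Phi_d(\zeta)=0}|A(\zeta)|^2.$$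
   Context: $\phi$ is Euler's totient function and $\Phi_d$ the $d$-th cyclotomic polynomial; the inner sums run over the primitive $d$-th roots of unity $\zeta$. *)

(* Defs.v *)
From HB Require Import structures.
From mathcomp Require Import all_boot all_order all_algebra all_field.
From mathcomp Require Import complex.
From mathcomp Require Import boolp classical_sets fsbigop reals.

Set Implicit Arguments.
Unset Strict Implicit.
Unset Printing Implicit Defensive.

Import Order.TTheory GRing.Theory Num.Theory.

Local Open Scope ring_scope.

(* Z[X]/(X^N - 1). An element is represented by its unique representative of
   degree < N. For N = 0 the modulus is not monic of positive degree and the
   library quotients by 'X instead, so N > 0 must be assumed. *)
Definition cycpoly (N : nat) : Type := {poly %/ ('X^N - 1 : {poly int})}.

(* Z_N is indexed by 'I_N rather than 'Z_N, which is Z/2 when N = 1. *)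
Definition weight (N : nat) (A : cycpoly N) (x : 'I_N) : int :=
  (A : {poly int})`_x.

(* gcd(a - c, N) does not depend on the integer representatives of a and c. *)
Definition divcount (N : nat) (A C : cycpoly N) (m : nat) : int :=
  \sum_(a < N) \sum_(c < N)
    weight A a * weight C c * (gcdz (a%:Z - c%:Z) N%:Z == m%:Z)%:R.

Definition ceval (R : realType) (N : nat) (A : cycpoly N) (z : R[i]) : R[i] :=
  (map_poly intr (A : {poly int})).[z].

Definition cyclotomic_roots (R : realType) (d : nat) : set R[i] :=
  [set z : R[i] | root (map_poly intr 'Phi_d) z]%classic.
Arguments cyclotomic_roots : clear implicits.

Definition cycpair (R : realType) (N : nat) (A C : cycpoly N) (d : nat) : R[i] :=
  \sum_(z \in cyclotomic_roots R d) ceval A z * Num.conj (ceval C z).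

Definition cycenergy (R : realType) (N : nat) (A : cycpoly N) (d : nat) : R[i] :=
  \sum_(z \in cyclotomic_roots R d) `|ceval A z| ^+ 2.

(* Main.v *)
Require Import Defs.
From HB Require Import structures.
From mathcomp Require Import all_boot all_order all_algebra all_field.
From mathcomp Require Import cyclic.
From mathcomp Require Import complex.
From mathcomp Require Import ring.
From mathcomp Require Import boolp classical_sets fsbigop reals.

(* Write c_d(n) for the Ramanujan sum of the n-th powers of the primitive d-th
   roots of unity. For d | N it depends on n only through gcd(n, N), so expanding
   A(zeta) conj(C(zeta)) and grouping the pairs (a, c) by m = gcd(a - c, N) gives
   sum_zeta A(zeta) conj(C(zeta)) = sum_(m | N) A_m[C] c_d(m).
   The theorem is then the orthogonality relation
   sum_(d | N) c_d(m) c_d(m') / phi(d) = [m = m'] N / phi(N / m),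
   which combines the symmetry phi(e) c_d(N/e) = phi(d) c_e(N/d) with Fourier
   inversion on Z_N for the indicator of the elements of a given order. *)

Set Implicit Arguments.
Unset Strict Implicit.
Unset Printing Implicit Defensive.

Import Order.TTheory GRing.Theory Num.Theory.

Local Open Scope ring_scope.

(** * Primitive roots of unity and cyclotomic polynomials *)

Lemma prim_root_exists (F : numClosedFieldType) (n : nat) :
  (0 < n)%N -> exists z : F, n.-primitive_root z.
Proof.
move=> n_gt0; have [r] := closed_field_poly_normal ('X^n - 1 : {poly F}).
rewrite lead_coefXnsubC // scale1r => rE.
suff /hasP[z _ prim_z] : has n.-primitive_root r by exists z.
apply: has_prim_root => //.
- by apply/allP => z; rewrite -root_prod_XsubC -rE.
- by rewrite -separable_prod_XsubC -rE separable_Xn_sub_1 // pnatr_eq0 -lt0n.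
- by rewrite -ltnS -(size_prod_XsubC r id) -rE size_XnsubC.
Qed.

Lemma prim_root_uniq (F : fieldType) (m n : nat) (z : F) :
  m.-primitive_root z -> n.-primitive_root z -> m = n.
Proof.
move=> pm pn; apply/eqP; rewrite eqn_dvd (prim_order_dvd pm) (prim_order_dvd pn).
by rewrite !prim_expr_order ?eqxx.
Qed.

(** By strong induction: both families multiply to X^n - 1 over the divisors of n, their factors at
    proper divisors agree, and these form a monic, hence cancellable, product. *)
Lemma map_Cyclotomic (F : numFieldType) (n : nat) (z : F) :
  n.-primitive_root z -> map_poly intr 'Phi_n = cyclotomic z n.
Proof.
elim/ltn_ind: n z => n IHn z prim_z; have n_gt0 := prim_order_gt0 prim_z.
have [uDn _ inDn] := divisors_correct n_gt0.
have := congr1 (map_poly (intr : int -> F)) (prod_Cyclotomic n_gt0).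
rewrite rmorphB rmorph1 /= map_polyXn (prod_cyclotomic prim_z) rmorph_prod /=.
rewrite (big_rem n) ?inDn //= [in RHS](big_rem n) ?inDn //= divnn n_gt0 expr1.
have -> : \prod_(d <- rem n (divisors n)) map_poly intr 'Phi_d =
          \prod_(d <- rem n (divisors n)) cyclotomic (z ^+ (n %/ d)) d.
  apply: eq_big_seq => d; rewrite mem_rem_uniq ?inE //= inDn => /andP[n'd ddvn].
  by apply: IHn; [rewrite ltn_neqAle n'd dvdn_leq | exact: dvdn_prim_root].
apply: mulIf; apply: monic_neq0.
by apply: monic_prod => d _; apply: cyclotomic_monic.
Qed.

Lemma root_map_Cyclotomic (F : numClosedFieldType) (n : nat) (z : F) :
  (0 < n)%N -> root (map_poly intr 'Phi_n) z = n.-primitive_root z.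
Proof.
move=> /(prim_root_exists F) [x prim_x].
by rewrite (map_Cyclotomic prim_x) root_cyclotomic.
Qed.

(** * Sums over divisors and over roots of unity *)

(** This uniqueness half of Moebius inversion lets Ramanujan sums be compared through their divisor
    sums, which have a closed form. *)
Lemma eq_divisor_sums (V : zmodType) (f g : nat -> V) (n : nat) :
    (0 < n)%N ->
    (forall e, (e %| n)%N ->
       \sum_(d <- divisors e) f d = \sum_(d <- divisors e) g d) ->
  f n = g n.
Proof.
elim/ltn_ind: n => n IHn n_gt0 fg.
have n_div : n \in divisors n by rewrite -dvdn_divisors.
have := fg n (dvdnn n); rewrite !(big_rem n n_div) /=.
suff -> : \sum_(d <- rem n (divisors n)) f d = \sum_(d <- rem n (divisors n)) g d.
  exact: addIr.
apply: eq_big_seq => d; rewrite mem_rem_uniq ?divisors_uniq // inE.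
rewrite -dvdn_divisors // => /andP[n'd d_dv_n].
apply: IHn => [||e e_dv_d]; last by apply: fg; apply: dvdn_trans d_dv_n.
  by rewrite ltn_neqAle n'd dvdn_leq.
exact: dvdn_gt0 d_dv_n.
Qed.

Lemma sum_fibers (V : nmodType) (I : finType) (J : eqType) (f : I -> J)
    (s : seq J) (G : I -> V) :
  uniq s ->
  \sum_(d <- s) \sum_(i | f i == d) G i = \sum_(i | f i \in s) G i.
Proof.
move=> s_uniq; rewrite (exchange_big_dep xpredT) //= [RHS]big_mkcond /=.
apply: eq_bigr => i _; rewrite -big_filter.
case: ifP => [fs | /negbT fNs].
  rewrite (eq_filter (a2 := pred1 (f i))) => [|d]; last by rewrite /= eq_sym.
  by rewrite filter_pred1_uniq // big_seq1.
rewrite (eq_in_filter (a2 := pred0)) ?filter_pred0 ?big_nil // => d ds.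
by apply/negbTE; apply: contraNneq fNs => ->.
Qed.

Lemma sum_multiples (V : nmodType) (N e : nat) (G : nat -> V) :
    (0 < N)%N -> (e %| N)%N ->
  \sum_(j < N | (N %/ e %| j)%N) G j = \sum_(i < e) G (N %/ e * i)%N.
Proof.
move=> N_gt0 eN; have e_gt0 := dvdn_gt0 N_gt0 eN.
have q_gt0 : (0 < N %/ e)%N by rewrite divn_gt0 // dvdn_leq.
(* With q for N / e, and q * e in place of N, the bijection is k -> q * k with inverse k -> k /
   q. *)
move: (N %/ e)%N (divnK eN) q_gt0 => q <- q_gt0 {N N_gt0 eN}.
have fP (k : 'I_e) : (q * k < q * e)%N by rewrite ltn_pmul2l.
rewrite (reindex (fun k => Ordinal (fP k))) /=.
  by apply: eq_bigl => k; rewrite dvdn_mulr.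
have gP (k : 'I_(q * e)) : (k %/ q < e)%N by rewrite ltn_divLR // [(e * q)%N]mulnC.
exists (fun k => Ordinal (gP k)) => k.
  by move=> _; apply: val_inj; rewrite /= mulKn.
by rewrite inE => qk; apply: val_inj; rewrite /= mulnC divnK.
Qed.

(** For x = z^k the sum is a geometric series, and (x - 1) times it is x^n - 1 = 0; hence it
    vanishes unless x = 1. *)
Lemma sum_unity_root_exp (F : fieldType) (n k : nat) (z : F) :
  n.-primitive_root z ->
  \sum_(i < n) z ^+ (i * k) = if (n %| k)%N then n%:R else 0.
Proof.
move=> prim_z; rewrite (prim_order_dvd prim_z).
under eq_bigr => i _ do rewrite mulnC exprM.
have [->|zk1] := eqVneq (z ^+ k) 1.
  by under eq_bigr => i _ do rewrite expr1n; rewrite sumr_const card_ord.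
have := subrX1 (z ^+ k) n; rewrite -exprM mulnC exprM (prim_expr_order prim_z).
rewrite expr1n subrr => /esym/eqP; rewrite mulf_eq0 subr_eq0 (negbTE zk1) /=.
by move/eqP.
Qed.

(* The order of j in Z_N. *)
Definition zord (N j : nat) : nat := (N %/ gcdn j N)%N.

Lemma zord_dvd (N j : nat) : (zord N j %| N)%N.
Proof. by rewrite /zord -{3}(divnK (dvdn_gcdr j N)) dvdn_mulr. Qed.

Lemma zord_eq (N i j : nat) :
  (0 < N)%N -> (zord N i == zord N j) = (gcdn i N == gcdn j N).
Proof.
move=> N_gt0; apply/eqP/eqP => [|e]; last by rewrite /zord e.
by move/(congr1 (fun d => N %/ d)%N); rewrite /zord !divnA ?dvdn_gcdr // !mulKn.
Qed.

Lemma zord_codivisor (N d : nat) : (0 < N)%N -> (d %| N)%N -> zord N (N %/ d) = d.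
Proof.
move=> N_gt0 dN; rewrite /zord (gcdn_idPl _) ?divnA ?mulKn //.
by rewrite -{2}(divnK dN) dvdn_mulr.
Qed.

(** * Ramanujan sums and their orthogonality *)

Section RamanujanSums.

Variables (F : numClosedFieldType) (N : nat) (w : F).
Hypothesis prim_w : N.-primitive_root w.

Let N_gt0 : (0 < N)%N := prim_order_gt0 prim_w.

(** [w ^+ j] has order [zord N j], so both sides express w^(j e) = 1. *)
Lemma zord_dvdE (e j : nat) : (e %| N)%N -> (zord N j %| e)%N = (N %/ e %| j)%N.
Proof.
move=> eN; rewrite (prim_order_dvd (exp_prim_root prim_w j)) -exprM.
by rewrite -(prim_order_dvd prim_w) -{1}(divnK eN) dvdn_pmul2r // (dvdn_gt0 N_gt0).
Qed.

(** For d | N, the powers [w ^+ j] with j of order d are the primitive d-th roots of unity, so this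
    is the classical c_d(n); one fixed [w] serves all d at once. *)
Definition ramanujan_sum (d n : nat) : F :=
  \sum_(j < N | zord N j == d) w ^+ (j * n).

(** The j whose order divides e are the multiples of N / e, so the left side is a full sum over the
    e-th roots of unity. *)
Lemma sum_ramanujan_sum (e n : nat) : (e %| N)%N ->
  \sum_(d <- divisors e) ramanujan_sum d n = if (e %| n)%N then e%:R else 0.
Proof.
move=> eN; have e_gt0 : (0 < e)%N := dvdn_gt0 N_gt0 eN.
rewrite sum_fibers ?divisors_uniq //.
under eq_bigl => j do rewrite -dvdn_divisors // zord_dvdE //.
rewrite (sum_multiples (fun k => w ^+ (k * n))) //.
rewrite -(sum_unity_root_exp n (dvdn_prim_root prim_w eN)).
by apply: eq_bigr => i _; rewrite -mulnA exprM.
Qed.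

(** For e | N the divisor sums only test whether e | n, that is, whether e divides gcd(n, N). *)
Lemma ramanujan_sum_gcd (d m n : nat) : (d %| N)%N ->
  gcdn m N = gcdn n N -> ramanujan_sum d m = ramanujan_sum d n.
Proof.
move=> dN mn.
apply: (eq_divisor_sums (f := ramanujan_sum^~ m) (g := ramanujan_sum^~ n)).
  exact: dvdn_gt0 dN.
move=> e /dvdn_trans/(_ dN) eN; rewrite !sum_ramanujan_sum //.
suff dvdE k : (e %| k)%N = (e %| gcdn k N)%N by rewrite dvdE mn -dvdE.
by rewrite dvdn_gcd eN andbT.
Qed.

Lemma ramanujan_sum0 (d : nat) : (d %| N)%N -> ramanujan_sum d 0 = (totient d)%:R.
Proof.
move=> dN.
apply: (eq_divisor_sums (f := ramanujan_sum^~ 0%N) (g := fun d => (totient d)%:R)).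
  exact: dvdn_gt0 dN.
move=> e /dvdn_trans/(_ dN) eN; rewrite sum_ramanujan_sum // dvdn0 -natr_sum.
have e_gt0 : (0 < e)%N := dvdn_gt0 N_gt0 eN.
congr _%:R; rewrite -{1}(sum_totient_dvd e).
rewrite -(big_mkord (fun d => d %| e)%N) -big_filter; apply: perm_big.
apply: uniq_perm; rewrite ?filter_uniq ?iota_uniq ?divisors_uniq // => i.
rewrite mem_filter mem_index_iota -dvdn_divisors //= ltnS.
by case ie: (i %| e)%N; rewrite //= dvdn_leq.
Qed.

Lemma ramanujan_sum_sym (d e : nat) : (d %| N)%N -> (e %| N)%N ->
  (totient e)%:R * ramanujan_sum d (N %/ e)
  = (totient d)%:R * ramanujan_sum e (N %/ d).
Proof.
(* Both sides are the double sum of w^(i j) over i of order d and j of order e: every j of order e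
   has the same gcd with N as N / e, and there are phi(e) of them. *)
have symE a b : (a %| N)%N -> (b %| N)%N ->
    (totient b)%:R * ramanujan_sum a (N %/ b)
    = \sum_(j < N | zord N j == b) \sum_(i < N | zord N i == a) w ^+ (i * j).
  move=> aN bN; rewrite -ramanujan_sum0 // /ramanujan_sum mulr_suml.
  apply: eq_bigr => j /eqP ojb; rewrite muln0 mul1r; apply: ramanujan_sum_gcd => //.
  by apply/eqP; rewrite -zord_eq // ojb zord_codivisor.
move=> dN eN; rewrite !symE // exchange_big.
by apply: eq_bigr => i _; apply: eq_bigr => j _; rewrite mulnC.
Qed.

(* The Fourier transform of the indicator of the elements of order e is the
   Ramanujan sum c_e; transforming once more gives N times that indicator. *)
Lemma ramanujan_sum_inversion (e e' : nat) : (e %| N)%N -> (e' %| N)%N ->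
  \sum_(d <- divisors N) ramanujan_sum e (N %/ d) * ramanujan_sum d (N %/ e')
  = if e == e' then N%:R else 0.
Proof.
move=> eN e'N; set n := (N %/ e')%N.
have n_gt0 : (0 < n)%N.
  by rewrite divn_gt0; [apply: dvdn_leq | apply: dvdn_gt0 e'N].
(* [N %/ d] may be replaced by any j of order d, since both have the same gcd with N; the orders d
   together then exhaust all j in Z_N. *)
transitivity (\sum_(d <- divisors N) \sum_(j < N | zord N j == d)
                ramanujan_sum e j * w ^+ (j * n)).
  apply: eq_big_seq => d; rewrite -dvdn_divisors // => dN.
  rewrite {2}/ramanujan_sum mulr_sumr; apply: eq_bigr => j /eqP ojd.
  congr (_ * _); apply: ramanujan_sum_gcd => //.
  by apply/eqP; rewrite -zord_eq // ojd zord_codivisor.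
rewrite sum_fibers ?divisors_uniq //.
under eq_bigl => j do rewrite -dvdn_divisors // zord_dvd.
under eq_bigr => j _ do rewrite mulr_suml.
rewrite exchange_big /=.
under eq_bigr => i _.
  under eq_bigr => j _ do rewrite -exprD [(i * j)%N]mulnC -mulnDr.
  rewrite sum_unity_root_exp //.
  over.
(* The sum over j keeps only those i with N | i + n; as 0 < i + n < 2N, this forces i = N - n. *)
have nP : (N - n < N)%N by rewrite ltn_subrL n_gt0.
have n_le : (n <= N)%N by rewrite leq_div.
rewrite -big_mkcondr /= (eq_bigl (fun i => (i == Ordinal nP) && (e == e'))).
  case: eqP => _; last by rewrite big_pred0 // => i; rewrite andbF.
  by under eq_bigl => i do rewrite andbT; rewrite big_pred1_eq.
move=> i; have -> : (N %| i + n)%N = (i == Ordinal nP).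
  apply/idP/eqP => [/dvdnP[[|[|c]] cN] | ->]; last by rewrite /= subnK.
  - by move: n_gt0; rewrite -(leq_add2l i) cN mul0n addn1 ltn0.
  - by apply: val_inj; rewrite /= -[N in RHS]mul1n -cN addnK.
  - have : (i + n < N + N)%N by rewrite -addSn leq_add.
    by rewrite cN addnn -mul2n ltn_pmul2r.
rewrite andbC; have [->|] //= := eqVneq i (Ordinal nP).
(* [N - n] represents -n, which has the same order as n = N / e'. *)
suff -> : zord N (N - n) = e' by rewrite eq_sym.
rewrite -[RHS](zord_codivisor N_gt0 e'N) -/n; apply/eqP; rewrite zord_eq //.
by rewrite -{2 3}(subnK n_le) gcdnDl gcdnDr gcdnC.
Qed.

(** The symmetry turns c_d(m) / phi(d) into c_(N/m)(N/d) / phi(N/m); the inversion formula then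
    applies to the orders N/m and N/m'. *)
Lemma ramanujan_sum_orthogonal (m m' : nat) : (m %| N)%N -> (m' %| N)%N ->
  \sum_(d <- divisors N)
    (totient d)%:R^-1 * ramanujan_sum d m * ramanujan_sum d m'
  = if m == m' then N%:R / (totient (N %/ m))%:R else 0.
Proof.
move=> mN m'N.
have codvd k : (k %| N)%N -> (N %/ k %| N)%N.
  by move=> kN; rewrite -{2}(divnK kN) dvdn_mulr.
have codK k : (k %| N)%N -> (N %/ (N %/ k))%N = k.
  by move=> kN; rewrite divnA // mulKn.
have tot0 k : (k %| N)%N -> (totient k)%:R != 0 :> F.
  by move=> kN; rewrite pnatr_eq0 -lt0n totient_gt0 (dvdn_gt0 N_gt0).
have -> : (m == m') = (N %/ m == N %/ m')%N.
  by apply/eqP/eqP => [->//|mm]; rewrite -(codK m) // mm codK.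
have /= inv := ramanujan_sum_inversion (codvd _ mN) (codvd _ m'N).
apply: (mulfI (tot0 _ (codvd _ mN))); rewrite mulr_sumr.
transitivity (if (N %/ m == N %/ m')%N then N%:R : F else 0); last first.
  by case: ifP => _; rewrite ?mulr0 // mulrC divfK ?tot0 ?codvd.
rewrite -inv; apply: eq_big_seq => d; rewrite -dvdn_divisors // => dN.
have := ramanujan_sum_sym dN (codvd _ mN); rewrite !codK // => sym.
rewrite !mulrA; congr (_ * _).
by rewrite mulrAC sym mulrAC mulfV ?mul1r ?tot0.
Qed.

(** Expanding the right side and summing over d first, orthogonality leaves only the diagonal m =
    m', where its factor N cancels 1 / N. *)
Lemma ramanujan_sum_parseval (a b : nat -> F) :
  \sum_(m <- divisors N) (totient (N %/ m))%:R^-1 * a m * b m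
  = \sum_(d <- divisors N) (N%:R * (totient d)%:R)^-1
      * (\sum_(m <- divisors N) a m * ramanujan_sum d m)
      * (\sum_(m <- divisors N) b m * ramanujan_sum d m).
Proof.
have N_neq0 : N%:R != 0 :> F by rewrite pnatr_eq0 -lt0n.
transitivity (\sum_(d <- divisors N) \sum_(m <- divisors N) \sum_(m' <- divisors N)
    a m * b m' / N%:R * ((totient d)%:R^-1 * ramanujan_sum d m * ramanujan_sum d m')).
  rewrite exchange_big; apply: eq_big_seq => m mN /=.
  rewrite exchange_big /= (bigD1_seq m) ?divisors_uniq //= -mulr_sumr.
  rewrite [X in _ + X]big1_seq => [|m' /andP[m'm m'N]].
    rewrite ramanujan_sum_orthogonal ?dvdn_divisors // eqxx addr0.
    by rewrite -[RHS]mulrA mulKf // [RHS]mulrC mulrA.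
  rewrite -mulr_sumr ramanujan_sum_orthogonal ?dvdn_divisors //.
  by rewrite eq_sym (negbTE m'm) mulr0.
apply: eq_bigr => d _; rewrite -mulrA big_distrlr mulr_sumr /=.
apply: eq_bigr => m _; rewrite [RHS]mulr_sumr; apply: eq_bigr => m' _.
by rewrite invfM; ring.
Qed.

End RamanujanSums.

(** * Polynomial values at roots of unity and gcd counts *)

Lemma mem_prim_roots (F : fieldType) (N d : nat) (w z : F) :
    N.-primitive_root w -> (d %| N)%N ->
  (z \in [seq w ^+ nat_of_ord j | j in [pred j : 'I_N | zord N j == d]])
  = d.-primitive_root z.
Proof.
move=> prim_w dN; apply/fintype.imageP/idP => [[j]|prim_z].
  by rewrite inE => /eqP <- ->; apply: exp_prim_root.
have zN : z ^+ N = 1 by apply/eqP; rewrite -(prim_order_dvd prim_z).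
have [i zi] := prim_rootP prim_w zN; exists i => //.
rewrite inE; apply/eqP; apply: (@prim_root_uniq _ _ _ z) => //.
by rewrite zi; apply: exp_prim_root.
Qed.

Lemma sum_cyclotomic_roots (R : realType) (N d : nat) (w : R[i]) (G : R[i] -> R[i]) :
    N.-primitive_root w -> (d %| N)%N ->
  \sum_(z \in cyclotomic_roots R d) G z = \sum_(j < N | zord N j == d) G (w ^+ j).
Proof.
move=> prim_w dN; have N_gt0 := prim_order_gt0 prim_w.
have d_gt0 := dvdn_gt0 N_gt0 dN.
pose r : seq R[i] :=
  [seq w ^+ nat_of_ord j | j in [pred j : 'I_N | zord N j == d]].
have r_uniq : uniq r.
  rewrite map_inj_in_uniq ?enum_uniq // => i j _ _ /eqP.
  by rewrite (eq_prim_root_expr prim_w) !modn_small // => /eqP/val_inj.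
have rE z : (z \in r) = d.-primitive_root z by exact: mem_prim_roots.
have -> : cyclotomic_roots R d = [set` r]%classic.
  apply/seteqP; split => z;
    by rewrite /cyclotomic_roots /= root_map_Cyclotomic // rE.
by rewrite -fsbig_seq // big_image.
Qed.

Lemma cevalE (R : realType) (N : nat) (A : cycpoly N) (z : R[i]) :
  (0 < N)%N -> ceval A z = \sum_(a < N) (weight A a)%:~R * z ^+ a.
Proof.
move=> N_gt0; rewrite /ceval (@horner_coef_wide _ N).
  by apply: eq_bigr => a _; rewrite coef_map.
apply: leq_trans (size_poly _ _) _; apply: leq_trans (size_npoly _) _.
(* [mk_monic] returns X^N - 1 itself because N > 0 makes it monic of size N + 1 > 1; the
   representative then has size at most N. *)
by rewrite /mk_monic size_XnsubC // monicXnsubC // ltnS N_gt0 /= size_XnsubC.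
Qed.

(** [a + (N - c)] represents a - c modulo N by a natural number, usable as an exponent of [w]; the
    added N leaves the gcd unchanged. *)
Lemma gcdz_subn (N a c : nat) :
  (c <= N)%N -> gcdz (a%:Z - c%:Z) N%:Z = (gcdn (a + (N - c)) N)%:Z.
Proof.
move=> cN; rewrite -[RHS]/(gcdz (a + (N - c))%N%:Z N%:Z) PoszD -subzn //.
by rewrite addrCA gcdzC [in RHS]gcdzC gcdzDl.
Qed.

(** Since |w| = 1, conjugation inverts [w ^+ (j * c)], and w^(j N) = 1 identifies the inverse. *)
Lemma conj_prim_root_exp (F : numClosedFieldType) (N j c : nat) (w : F) :
  N.-primitive_root w -> (c <= N)%N -> (w ^+ (j * c))^* = w ^+ (j * (N - c)).
Proof.
move=> prim_w cN; have N_gt0 := prim_order_gt0 prim_w.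
have w1 : `|w| = 1.
  apply/eqP; rewrite -(@pexpr_eq1 _ _ N) //.
  by rewrite -normrX prim_expr_order ?normr1.
have x1 : `|w ^+ (j * c)| = 1 by rewrite normrX w1 expr1n.
apply: (mulfI (x := w ^+ (j * c))); first by rewrite -normr_eq0 x1 oner_eq0.
rewrite -normCK x1 expr1n -exprD -mulnDr subnKC // mulnC exprM.
by rewrite (prim_expr_order prim_w) expr1n.
Qed.

Lemma cycpairE (R : realType) (N d : nat) (w : R[i]) (A C : cycpoly N) :
    N.-primitive_root w -> (d %| N)%N ->
  cycpair R A C d
  = \sum_(m <- divisors N) (divcount A C m)%:~R * ramanujan_sum N w d m.
Proof.
move=> prim_w dN; have N_gt0 := prim_order_gt0 prim_w.
rewrite /cycpair (sum_cyclotomic_roots _ prim_w dN).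
(* Expanding at w^j and summing over j first, the exponent is j * (a + (N - c)), so each pair (a, c)
   contributes one Ramanujan sum. *)
transitivity (\sum_(a < N) \sum_(c < N)
    ((weight A a)%:~R * (weight C c)%:~R) * ramanujan_sum N w d (a + (N - c))).
  under eq_bigr => j _.
    rewrite !cevalE // rmorph_sum big_distrlr.
    over.
  rewrite exchange_big; apply: eq_bigr => a _ /=.
  rewrite exchange_big; apply: eq_bigr => c _ /=.
  rewrite /ramanujan_sum mulr_sumr; apply: eq_bigr => j _.
  rewrite rmorphM /= -exprM rmorph_int -[(w ^+ j) ^+ c]exprM.
  rewrite (conj_prim_root_exp _ prim_w) 1?ltnW //.
  by rewrite mulrACA -exprD -mulnDr.
under [RHS]eq_bigr => m _.
  rewrite rmorph_sum mulr_suml.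
  under eq_bigr => a _ do rewrite rmorph_sum mulr_suml.
  over.
rewrite [RHS]exchange_big; apply: eq_bigr => a _ /=.
rewrite [RHS]exchange_big; apply: eq_bigr => c _ /=.
(* For fixed a and c, the indicator in [divcount] selects the single divisor m = g, and c_d takes
   the same value at g as at a + (N - c). *)
set g := gcdn (a + (N - c)) N.
have gN : g \in divisors N by rewrite -dvdn_divisors ?dvdn_gcdr.
rewrite (bigD1_seq g) ?divisors_uniq //= big1 => [|m m'g].
  rewrite gcdz_subn 1?ltnW // eqxx mulr1 addr0 rmorphM; congr (_ * _).
  by apply: (ramanujan_sum_gcd prim_w) => //; rewrite /g -gcdnA gcdnn.
by rewrite gcdz_subn 1?ltnW // eqz_nat eq_sym (negbTE m'g) mulr0 rmorph0 mul0r.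
Qed.

Lemma cycenergyE (R : realType) (N : nat) (A : cycpoly N) (d : nat) :
  cycenergy R A d = cycpair R A A d.
Proof. by apply: eq_fsbigr => z _; rewrite normCK. Qed.

Lemma divcount_cycpair (R : realType) (N : nat) (A B C D : cycpoly N) :
  (0 < N)%N ->
  \sum_(m <- divisors N)
      (totient (N %/ m))%:R^-1 * (divcount A C m)%:~R * (divcount B D m)%:~R
  = \sum_(d <- divisors N)
      (N%:R * (totient d)%:R)^-1 * cycpair R A C d * cycpair R B D d :> R[i].
Proof.
move=> N_gt0.
have [w prim_w] := prim_root_exists (R[i] : numClosedFieldType) N_gt0.
rewrite (ramanujan_sum_parseval prim_w (fun m => (divcount A C m)%:~R)).
by apply: eq_big_seq => d; rewrite -dvdn_divisors // => dN;
  rewrite !(cycpairE _ _ prim_w dN).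
Qed.

Theorem mainTheorem4 (R : realType) (N k : nat) (p alpha : 'I_k -> nat)
    (p_prime : forall j, prime (p j))
    (p_inj : injective p)
    (alpha_ge1 : forall j, (1 <= alpha j)%N)
    (N_def : N = (\prod_(j < k) p j ^ alpha j)%N)
    (A B C D : cycpoly N) :
  (\sum_(m <- divisors N)
      (totient (N %/ m))%:R^-1 * (divcount A C m)%:~R * (divcount B D m)%:~R
   = \sum_(d <- divisors N)
      (N%:R * (totient d)%:R)^-1 * cycpair R A C d * cycpair R B D d :> R[i])
  /\
  (\sum_(m <- divisors N)
      (totient (N %/ m))%:R^-1 * (divcount A A m)%:~R * (divcount B B m)%:~R
   = \sum_(d <- divisors N)
      (N%:R * (totient d)%:R)^-1 * cycenergy R A d * cycenergy R B d :> R[i]).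
Proof.
have N_gt0 : (0 < N)%N.
  by rewrite N_def prodn_gt0 // => j; rewrite expn_gt0 prime_gt0.
split; first exact: divcount_cycpair.
rewrite (divcount_cycpair R A B A B N_gt0).
by apply: eq_bigr => d _; rewrite !cycenergyE.
Qed.
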